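(* Let $f:2^{[n]}\to\mathbb{Z}$ be submodular with $f(\emptyset)=0$ and $|f(S)|\le M$ for all $S\subseteq[n]$, where $M\in\mathbb{Z}_{>0}$, given by an evaluation oracle. Let $\mathcal{F}=\{S\subseteq[n]: |S|\le M\}$, and for each $S\in\mathcal{F}$ let $A(S)=S\cup\{i\notin S : f(S\cup\{i\})\le f(S)\}$. The algorithm that computes all $A(S)$, $S\in\mathcal{F}$, and returns $A(S_{\mathrm{out}})$ for some $S_{\mathrm{out}}\in\arg\min_{S\in\mathcal{F}} f(A(S))$ outputs a minimizer of $f$, and it can be implemented in 2 rounds using $O(n^{M+1})$ queries to the evaluation oracle.
   Context: $[n]=\{1,\dots,n\}$. A function $f:2^{[n]}\to\mathbb{R}$ is submodular if $f(S\cup\{i\})-f(S)\ge f(T\cup\{i\})-f(T)$ for all $S\subseteq T\subseteq[n]\setminus\{i\}$ and $i\in[n]$. An evaluation oracle returns $f(S)$ when queried with $S\subseteq[n]$. Parallel model: the algorithm proceeds in rounds; in each round it submits a set of queries in parallel (queries in a round may depend only on answers from earlier rounds); the total number of queries is the query complexity. *)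

(* Defs.v *)
From HB Require Import structures.
From mathcomp Require Import all_boot all_order all_algebra.

Set Implicit Arguments.
Unset Strict Implicit.
Unset Printing Implicit Defensive.

Import Order.TTheory GRing.Theory Num.Theory.

Local Open Scope ring_scope.

(* The ground set [n] is 'I_n. *)

Definition submodular (R : numDomainType) (n : nat)
    (f : {set 'I_n} -> R) : Prop :=
  forall (i : 'I_n) (S T : {set 'I_n}),
    S \subset T -> T \subset [set~ i] ->
    f (S :|: [set i]) - f S >= f (T :|: [set i]) - f T.

Definition bounded_submodular (n M : nat) (f : {set 'I_n} -> int) : Prop :=
  [/\ submodular f, f set0 = 0 & forall S : {set 'I_n}, `|f S| <= M%:Z].

Definition is_minimizer (n : nat) (f : {set 'I_n} -> int)
    (U : {set 'I_n}) : Prop :=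
  forall T : {set 'I_n}, f U <= f T.

Definition small_sets (n M : nat) : {set {set 'I_n}} :=
  [set S : {set 'I_n} | (#|S| <= M)%N].

Definition augment (n : nat) (f : {set 'I_n} -> int)
    (S : {set 'I_n}) : {set 'I_n} :=
  S :|: [set i : 'I_n | (i \notin S) && (f (S :|: [set i]) <= f S)].

Definition argmin_augment (n M : nat) (f : {set 'I_n} -> int)
    (Sout : {set 'I_n}) : Prop :=
  Sout \in small_sets n M /\
  forall S : {set 'I_n}, S \in small_sets n M ->
    f (augment f Sout) <= f (augment f S).

(* A deterministic parallel algorithm with access to an oracle of type Q -> V
   and result in T.  The oracle is reachable only through [Round]: everything
   that follows a round is a function of the answers to the set of queries
   submitted in that round (and, by nesting, in the earlier ones). *)
Inductive oracle_alg (Q : finType) (V T : Type) : Type :=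
| Return (t : T)
| Round (qs : {set Q})
    (next : ({q : Q | q \in qs} -> V) -> oracle_alg Q V T).

Fixpoint run (Q : finType) (V T : Type) (f : Q -> V)
    (alg : oracle_alg Q V T) : T :=
  match alg with
  | Return t => t
  | Round qs next => run f (next (fun q => f (val q)))
  end.

Fixpoint rounds (Q : finType) (V T : Type) (f : Q -> V)
    (alg : oracle_alg Q V T) : nat :=
  match alg with
  | Return _ => 0%N
  | Round qs next => (rounds f (next (fun q => f (val q)))).+1
  end.

Fixpoint queries (Q : finType) (V T : Type) (f : Q -> V)
    (alg : oracle_alg Q V T) : nat :=
  match alg with
  | Return _ => 0%N
  | Round qs next => (#|qs| + queries f (next (fun q => f (val q))))%N
  end.

(* The result is a pair: the table of the computed sets A(S), whose values
   outside the family of small sets are irrelevant, and the returned set. *)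
Definition correct_output (n M : nat) (f : {set 'I_n} -> int)
    (res : ({set 'I_n} -> {set 'I_n}) * {set 'I_n}) : Prop :=
  (forall S : {set 'I_n}, S \in small_sets n M -> res.1 S = augment f S) /\
  (exists2 Sout : {set 'I_n},
     argmin_augment M f Sout & res.2 = augment f Sout).

(* Main.v *)
Require Import Defs.
From HB Require Import structures.
From mathcomp Require Import all_boot all_order all_algebra.
From mathcomp Require Import zify lra.

Set Implicit Arguments.
Unset Strict Implicit.
Unset Printing Implicit Defensive.

Import Order.TTheory GRing.Theory Num.Theory.

(** Fix [T] and grow [S] inside [T] from the empty set, adding any element of
    strictly positive marginal value.  Integrality gives [#|S| <= f S <= M], so
    this stops with [S] in the family of small sets.  Then [T \subset A(S)], and
    by submodularity the elements of [A(S)] outside [T] can be added to [T]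
    without increasing [f], so [f (A(S)) <= f T].

    The oracle is queried on the nonempty sets of size at most [M + 1], which
    determines every [A(S)], and then on the nonempty [A(S)].  The empty set is
    not queried, since [f set0 = 0] is known; this is also what makes the bound
    hold for [n = 0], where [n ^ (M + 1) = 0]. *)

Section Submodular.

Variables (n : nat) (f : {set 'I_n} -> int).
Hypothesis f_submod : submodular f.

(** Induction on [#|D|]: split off some [x] in [D]. Since [x] lies outside [T :|: (D :\ x)], which
    contains [S], its marginal value there is at most its marginal value at [S]. *)
Lemma submodular_setU_le (S T D : {set 'I_n}) :
    S \subset T -> [disjoint D & T] ->
    (forall i, i \in D -> f (S :|: [set i]) <= f S)%R ->
  (f (T :|: D) <= f T)%R.
Proof.
move Dk : #|D| => k; elim: k D Dk => [|k IHk] D Dk sST dDT leD.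
  by move/eqP: Dk; rewrite cards_eq0 => /eqP->; rewrite setU0.
have [x xD] : exists x, x \in D by apply/set0Pn; rewrite -cards_eq0 Dk.
have dD'T : [disjoint D :\ x & T] by apply: disjointWl dDT; rewrite subD1set.
have leD' : (f (T :|: (D :\ x)) <= f T)%R.
  apply: IHk => //; first by move: Dk; rewrite (cardsD1 x) xD => -[].
  by move=> i /setD1P[_ iD]; apply: leD.
have TDE : T :|: D = (T :|: (D :\ x)) :|: [set x].
  by rewrite -setUA [_ :\ x :|: _]setUC setD1K.
have xT : x \notin T by rewrite (disjointFr dDT xD).
have := @f_submod x S (T :|: (D :\ x)) (subset_trans sST (subsetUl _ _)).
rewrite -TDE subsetC sub1set !inE eqxx (negPf xT) => /(_ isT).
have := leD x xD; lra.
Qed.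

Lemma augment_le (S T : {set 'I_n}) :
    S \subset T ->
    (forall i, i \in T -> i \notin S -> f (S :|: [set i]) <= f S)%R ->
  (f (augment f S) <= f T)%R.
Proof.
move=> sST leT.
have sTA : T \subset augment f S.
  apply/subsetP => i iT; rewrite !inE.
  by case: (boolP (i \in S)) => //= iS; apply: leT.
have <- : T :|: (augment f S :\: T) = augment f S.
  by rewrite -{1}(setIidPr sTA) setID.
apply: (submodular_setU_le sST).
  by rewrite -setI_eq0 setIDAC setD_eq0 subsetIr.
move=> i /setDP[]; rewrite !inE => /orP[iS /negP[] | /andP[] //].
exact: (subsetP sST).
Qed.

(** Maximality replaces the greedy loop: take [S] maximal in [T] with [#|S| <= f S]. A positive
    integer marginal is at least 1, so adding such an element would preserve the inequality. *)
Lemma ex_saturated_subset (T : {set 'I_n}) :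
  f set0 = 0%R ->
  exists S : {set 'I_n}, [/\ S \subset T, (#|S|%:Z <= f S)%R
    & forall i, i \in T -> i \notin S -> (f (S :|: [set i]) <= f S)%R].
Proof.
move=> f0.
have P0 : (set0 \subset T) && (#|@set0 'I_n|%:Z <= f set0)%R.
  by rewrite sub0set cards0 f0 lexx.
have [S /maxsetP[/andP[sST leS] maxS] _] :=
  @maxset_exists _ (fun S => (S \subset T) && (#|S|%:Z <= f S)%R) _ P0.
exists S; split=> // i iT iS; rewrite leNgt; apply/negP => ltS.
have /maxS/(_ (subsetUl _ _)) SE :
    (S :|: [set i] \subset T) && (#|S :|: [set i]|%:Z <= f (S :|: [set i]))%R.
  rewrite subUset sST sub1set iT /= setUC cardsU1 iS setUC.
  by move: ltS leS; lia.
by case/negP: iS; rewrite -SE !inE eqxx orbT.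
Qed.

End Submodular.

Lemma augment_argmin_minimizer (n M : nat) (f : {set 'I_n} -> int)
    (Sout : {set 'I_n}) :
  bounded_submodular M f -> argmin_augment M f Sout ->
  is_minimizer f (augment f Sout).
Proof.
case=> f_submod f0 fM [_ minS] T.
have [S [sST cardS satS]] := ex_saturated_subset T f0.
apply: le_trans (augment_le f_submod sST satS); apply: minS.
by rewrite inE; have := fM S; lia.
Qed.

Lemma card_nonempty_small_sets (n m : nat) :
  #|small_sets n m :\ set0| <= n ^ m.
Proof.
rewrite -[X in X ^ _]card_ord -[X in _ ^ X]card_ord -card_ffun.
rewrite -[leqRHS]cardsT.
apply: leq_trans (leq_imset_card
  (fun t : {ffun 'I_m -> 'I_n} => [set t j | j : 'I_m]) _).
apply/subset_leq_card/subsetP => S; rewrite !inE => /andP[/set0Pn[x xS] leSm].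
(* The enumeration of [S], padded to length [m] with its own element [x]; this is where nonemptiness
   enters. *)
apply/imsetP; exists [ffun j : 'I_m => nth x (enum S) j] => //.
apply/setP => y; apply/idP/imsetP => [yS | [j _ ->]].
  have ltj : index y (enum S) < m.
    by apply: leq_trans leSm; rewrite cardE index_mem mem_enum.
  by exists (Ordinal ltj); rewrite // ffunE nth_index ?mem_enum.
rewrite ffunE; have [ltj | gej] := ltnP j (size (enum S)).
  by rewrite -mem_enum mem_nth.
by rewrite nth_default.
Qed.

Lemma set_ord0 (S : {set 'I_0}) : S = set0.
Proof. by apply/setP => -[]. Qed.

Section Algorithm.

Variables n M : nat.

(** The default 0 is the true value at the unqueried [set0]. *)
Definition answer_table (qs : {set {set 'I_n}}) (a : {q | q \in qs} -> int)
    (S : {set 'I_n}) : int :=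
  oapp a 0%R (insub S).

Lemma answer_tableE (f : {set 'I_n} -> int) (qs : {set {set 'I_n}}) S :
  f set0 = 0%R -> S \in qs ->
  @answer_table (qs :\ set0) (fun q => f (val q)) S = f S.
Proof.
move=> f0 Sqs; rewrite /answer_table; case: insubP => [q _ /= -> //|].
by rewrite !inE Sqs andbT negbK => /eqP->.
Qed.

(** Computing A(S) reads values only at [S] and at [S] plus one element, so size [M.+1] suffices for
    the first round. *)
Lemma eq_augment (f g : {set 'I_n} -> int) S :
    S \in small_sets n M -> {in small_sets n M.+1, f =1 g} ->
  augment f S = augment g S.
Proof.
rewrite inE => leSM eqfg; rewrite /augment; congr (_ :|: _).
apply/setP => i; rewrite !inE; case: (boolP (i \in S)) => //= iS.
by rewrite !eqfg // inE ?(leqW leSM) // setUC cardsU1 iS.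
Qed.

Definition argmin_value (A : {set 'I_n} -> {set 'I_n})
    (g : {set 'I_n} -> int) : {set 'I_n} :=
  [arg min_(S < set0 in small_sets n M) g (A S)]%O.

Definition second_round_queries (A : {set 'I_n} -> {set 'I_n}) :=
  [set A S | S in small_sets n M] :\ set0.

Definition two_round_alg :
    oracle_alg {set 'I_n} int (({set 'I_n} -> {set 'I_n}) * {set 'I_n}) :=
  @Round _ _ _ (small_sets n M.+1 :\ set0) (fun a =>
    let A := augment (answer_table a) in
    @Round _ _ _ (second_round_queries A) (fun b =>
      Return _ _ (A, A (argmin_value A (answer_table b))))).

Lemma set0_small : set0 \in small_sets n M.
Proof. by rewrite inE cards0. Qed.

Lemma two_round_alg_correct f :
  bounded_submodular M f -> correct_output M f (run f two_round_alg).
Proof.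
case=> _ f0 _ /=.
set A := augment (answer_table _).
have AE S : S \in small_sets n M -> A S = augment f S.
  by move=> smallS; apply: eq_augment => // U smallU; rewrite answer_tableE.
split=> //=; rewrite /argmin_value /second_round_queries.
case: Order.TotalTheory.arg_minP => [|S smallS minS]; first exact: set0_small.
exists S; last exact: AE.
split=> // U smallU; have := minS U smallU.
by rewrite !answer_tableE ?imset_f // !AE.
Qed.

Lemma card_second_round_queries A :
  #|second_round_queries A| <= (n ^ M.+1).*2.
Proof.
(* For [n = 0] the bound is 0, and [set0], the only set, is not queried. Otherwise there are at most
   [n ^ M] nonempty small sets, and the empty one, whose A may be nonempty, adds 1; each term is at
   most [n ^ M.+1]. *)
rewrite /second_round_queries; case: n A => [|k] A.
  by rewrite exp0n // leqn0 cards_eq0; apply/eqP/setP=> S;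
    rewrite !inE (set_ord0 S) eqxx.
apply: leq_trans (subset_leq_card (subD1set _ _)) _.
apply: leq_trans (leq_imset_card _ _) _.
rewrite (cardsD1 set0) -addnn leq_add //.
  by apply: leq_trans (leq_b1 _) _; rewrite expn_gt0.
apply: leq_trans (card_nonempty_small_sets _ _) _.
by rewrite leq_pexp2l.
Qed.

Lemma queries_two_round_alg f : queries f two_round_alg <= 3 * n ^ M.+1.
Proof.
rewrite /= addn0 mulSn leq_add ?card_nonempty_small_sets //.
by rewrite mul2n card_second_round_queries.
Qed.

End Algorithm.

Theorem mainTheorem3 :
  (forall (n M : nat) (f : {set 'I_n} -> int),
     0 < M -> bounded_submodular M f ->
     forall Sout : {set 'I_n},
       argmin_augment M f Sout -> is_minimizer f (augment f Sout)) /\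
  (exists C : nat, forall n M : nat, 0 < M ->
     exists alg : oracle_alg {set 'I_n} int
                    (({set 'I_n} -> {set 'I_n}) * {set 'I_n}),
     forall f : {set 'I_n} -> int, bounded_submodular M f ->
       [/\ correct_output M f (run f alg),
           rounds f alg = 2
         & queries f alg <= C * n ^ (M + 1)]).
Proof.
split=> [n M f _ fM Sout | ].
  exact: augment_argmin_minimizer.
(* The constant is 1 for the first round plus 2 for the second. *)
exists 3 => n M _; exists (two_round_alg n M) => f fM; split=> //.
  exact: two_round_alg_correct.
by rewrite addn1 queries_two_round_alg.
Qed.
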